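(* Let $\theta_f\in(0,\pi)$. With the curves $\alpha_{\theta_f}^\epsilon$ ($\epsilon\in(0,1)$) and $\alpha_{\theta_f}$ defined in the context, $$\lim_{\epsilon\to0}d\left(\alpha_{\theta_f}^\epsilon,\alpha_{\theta_f}\right)=0,\qquad\text{where}\qquad d\left(\alpha_{\theta_f}^\epsilon,\alpha_{\theta_f}\right)=\sup_{0\le s\le1}\ \inf_{0\le t\le1}\left|\alpha_{\theta_f}^\epsilon(s)-\alpha_{\theta_f}(t)\right|.$$
   Context: Strong solution curves: for $D>0$ let $r_c(D)\in(0,1)$ be the unique root in $(0,1)$ of $r^3+2Dr-2D=0$. Define $$r_D^S(s)=\begin{cases}2(r_c(D)-1)s+1, & 0\le s\le \tfrac12,\\ 2(1-r_c(D))(s-1)+1, & \tfrac12<s\le 1,\end{cases}$$ and, with $f_D(u)=\sqrt{\dfrac{2(1-u)D}{u^5-2u^2D(1-u)}}$ for $u\in(r_c(D),1]$, $$\theta_D^S(s)=\begin{cases}\displaystyle\int_{r_D^S(s)}^1 f_D(u)\,du, & 0\le s\le\tfrac12,\\[2mm] \displaystyle\theta_D^S(1/2)+\int_{r_c(D)}^{r_D^S(s)}f_D(u)\,du, & \tfrac12\le s\le1.\end{cases}$$ For $\theta_f\in(0,2\pi/3)$, $D(\theta_f)$ denotes the unique $D>0$ with $\theta_D^S(1)=\theta_f$. Critical parameter and angle: for $\epsilon\in(0,1)$, $D(\epsilon)>0$ is the unique value of $D$ for which the strong solution curve touches the circle of radius $\epsilon$ tangentially, i.e. $r_c(D(\epsilon))=\epsilon$,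 and $\theta_c^\epsilon=\theta_{D(\epsilon)}^S(1/2)\in(0,\pi/3)$. Curves riding on the obstacle: for $D>0$ with $r_c(D)\le\epsilon$ let $s_D^\epsilon=\min\{s\in[0,1]: r_D^S(s)=\epsilon\}$ and $$\mathcal{F}_{D,\theta_f}^\epsilon(s)=\begin{cases}\big(r_D^S(h(s))\cos\theta_D^S(h(s)),\ r_D^S(h(s))\sin\theta_D^S(h(s))\big), & s\in[0,1/3),\\ (\epsilon\cos t(s),\ \epsilon\sin t(s)), & s\in[1/3,2/3],\\ \big(r_D^S(j(s))\cos l(s),\ r_D^S(j(s))\sin l(s)\big), & s\in(2/3,1],\end{cases}$$ where $h(s)=3s_D^\epsilon s$, $j(s)=3s_D^\epsilon s+1-3s_D^\epsilon$, $l(s)=\theta_D^S(j(s))+\theta_f-\theta_D^S(1)$, and $t(s)=3(\theta_f-2\theta_D^S(s_D^\epsilon))s+3\theta_D^S(s_D^\epsilon)-\theta_f$. Curves on the annulus: $$\alpha_{\theta_f}^\epsilon(s)=\begin{cases}\big(r^S_{D(\theta_f)}(s)\cos\theta^S_{D(\theta_f)}(s),\ r^S_{D(\theta_f)}(s)\sin\theta^S_{D(\theta_f)}(s)\big), & \theta_f/2\le\theta_c^\epsilon,\\ \mathcal{F}_{D(\epsilon),\theta_f}^\epsilon(s), & \theta_f/2>\theta_c^\epsilon.\end{cases}$$ Weak solution curves: $r^W(s)=1-2s$ for $0\le s\le\frac12$ and $r^W(s)=2s-1$ for $\frac12<s\le1$; $\theta^W(s)=0$ for $0\le s\le\frac12$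 and $\theta^W(s)=\theta_f$ for $\frac12<s\le1$. Curves on the disk: $$\alpha_{\theta_f}(s)=\begin{cases}\big(r^S_{D(\theta_f)}(s)\cos\theta^S_{D(\theta_f)}(s),\ r^S_{D(\theta_f)}(s)\sin\theta^S_{D(\theta_f)}(s)\big), & \theta_f<2\pi/3,\\ \big(r^W(s)\cos\theta^W(s),\ r^W(s)\sin\theta^W(s)\big), & \theta_f\ge2\pi/3.\end{cases}$$ *)

(* Defs.v *)
From HB Require Import structures.
From mathcomp Require Import all_boot all_order all_algebra.
From mathcomp Require Import all_classical all_reals all_analysis.

Set Implicit Arguments.
Unset Strict Implicit.
Unset Printing Implicit Defensive.

Import Order.TTheory GRing.Theory Num.Theory.
Import numFieldNormedType.Exports.

Local Open Scope classical_set_scope.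
Local Open Scope ring_scope.

(* Definite descriptions ("the unique x such that P x") are written
   [xget 0 P]; the default value 0 is only returned when P is empty. *)

Section strong_solution.
Context {R : realType}.
Implicit Types D u s : R.

Definition rc D : R :=
  xget 0 [set r : R | 0 < r < 1 /\ r ^+ 3 + 2 * D * r - 2 * D = 0].

Definition rS D s : R :=
  if s <= 2^-1 then 2 * (rc D - 1) * s + 1
  else 2 * (1 - rc D) * (s - 1) + 1.

Definition fD D u : R :=
  Num.sqrt (2 * (1 - u) * D / (u ^+ 5 - 2 * u ^+ 2 * D * (1 - u))).

(* fD D is defined on ]rc D, 1] and blows up, integrably, at rc D: the
   integrals below are improper, and are rendered as Lebesgue integrals. *)
Definition int_fD D (a b : R) : R :=
  \int[lebesgue_measure]_(u in `]a, b]) fD D u.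

Definition thetaS D s : R :=
  if s <= 2^-1 then int_fD D (rS D s) 1
  else int_fD D (rS D 2^-1) 1 + int_fD D (rc D) (rS D s).

Definition D_of_angle (thf : R) : R :=
  xget 0 [set D : R | 0 < D /\ thetaS D 1 = thf].

(* The strong solution curve of parameter D touches the circle of radius eps
   tangentially when its minimal radius rc D is eps. *)
Definition D_of_radius (eps : R) : R :=
  xget 0 [set D : R | 0 < D /\ rc D = eps].

Definition theta_c (eps : R) : R := thetaS (D_of_radius eps) 2^-1.

End strong_solution.

Section curves.
Context {R : realType}.
Implicit Types D s eps thf : R.

Definition polar (r th : R) : R * R := (r * cos th, r * sin th).

Definition set_min (A : set R) : R := xget 0 [set m : R | A m /\ lbound A m].

Definition s_hit eps D : R :=
  set_min [set s : R | 0 <= s <= 1 /\ rS D s = eps].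

Definition strong_curve D s : R * R := polar (rS D s) (thetaS D s).

Definition riding_curve eps D thf s : R * R :=
  let sD := s_hit eps D in
  let h := 3 * sD * s in
  let j := 3 * sD * s + 1 - 3 * sD in
  let l := thetaS D j + thf - thetaS D 1 in
  let t := 3 * (thf - 2 * thetaS D sD) * s + 3 * thetaS D sD - thf in
  if s < 3^-1 then polar (rS D h) (thetaS D h)
  else if s <= 2 / 3 then polar eps t
  else polar (rS D j) l.

Definition annulus_curve eps thf s : R * R :=
  if thf / 2 <= theta_c eps then strong_curve (D_of_angle thf) s
  else riding_curve eps (D_of_radius eps) thf s.

Definition rW s : R := if s <= 2^-1 then 1 - 2 * s else 2 * s - 1.

Definition thetaW thf s : R := if s <= 2^-1 then 0 else thf.

Definition disk_curve thf s : R * R :=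
  if thf < 2 * pi / 3 then strong_curve (D_of_angle thf) s
  else polar (rW s) (thetaW thf s).

(* The library norm on R * R is the max norm, hence this definition. *)
Definition eucl_dist (p q : R * R) : R :=
  Num.sqrt ((p.1 - q.1) ^+ 2 + (p.2 - q.2) ^+ 2).

(* Extended-real supremum and infimum: unlike [sup] and [inf] on R, they have
   no default value on unbounded sets. *)
Definition curve_dist (a b : R -> R * R) : \bar R :=
  ereal_sup [set ereal_inf [set (eucl_dist (a s) (b t))%:E | t in `[0, 1]%classic]
            | s in `[0, 1]%classic].

End curves.

(* Main.v *)
Require Import Defs.
From HB Require Import structures.
From mathcomp Require Import all_boot all_order all_algebra.
From mathcomp Require Import all_classical all_reals all_analysis.
From mathcomp Require Import measurable_realfun ring lra.
Set Implicit Arguments.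
Unset Strict Implicit.
Unset Printing Implicit Defensive.

Import Order.TTheory GRing.Theory Num.Theory.
Import numFieldNormedType.Exports.
Local Open Scope classical_set_scope.
Local Open Scope ring_scope.

(** Write [c] for the minimal radius [rc D], so that [2 * D * (1 - c) = c ^+ 3].
    Everything rests on comparing [fD D] with the explicit function
      [angle_density c u = 1 / (u * sqrt ((u / c) ^ 3 - 1))],
    obtained from [fD D] by replacing [(1 - u) / (1 - c)] with [1]; it has the
    primitive
      [angle_primitive c u = 2 / 3 * atan (sqrt ((u / c) ^ 3 - 1))],
    which vanishes at [c] and stays below [pi / 3]. On the interval from [c] to
    [1] the comparison is two-sided:
      [(1 - u) * angle_density c u <= fD D u <= angle_density c u]
    ([angle_density_le_fD] and [fD_le_angle_density]).

    The upper bound gives [theta_c eps < pi / 3] for every [eps] ([theta_c_lt]).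
    Integrated only over a short interval from [c] to a fixed [d], the lower
    bound gives [theta_c eps >= (1 - d) * angle_primitive eps d], whose limit is
    [(1 - d) * pi / 3] as [eps] tends to [0]; hence [theta_c eps] eventually
    exceeds any number below [pi / 3] ([theta_c_ge]).

    If [thf < 2 * pi / 3], then eventually [thf / 2 <= theta_c eps], and the
    annulus curve is the disk curve itself. If [thf >= 2 * pi / 3], the annulus
    curve always rides on the obstacle, and each of its points is within [eps]
    of the weak curve ([riding_curve_near_weak]). On the obstacle this is the
    distance to the origin. On an arm, the point at radius [r] deviates from the
    straight ray by the angle [psi], the integral of [fD D] from [r] to [1]; its
    orthogonal projection on the ray is at distance [r * sin psi], and the upper
    bound yields [psi <= pi / 2 - atan w] with [1 + w ^ 2 = (r / eps) ^ 3], so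
    that [r * sin psi <= r * (eps / r) ^ (3 / 2) <= eps]. In both cases the
    distance lies between [0] and [eps]. *)

(** * An improper fundamental theorem of calculus *)

Lemma continuous_measurable_itv_oc (R : realType) (f : R -> R) (a b : R) :
  (forall x, a < x <= b -> {for x, continuous f}) ->
  measurable_fun `]a, b] f.
Proof.
move=> cf; apply: subspace_continuous_measurable_fun => //.
by apply: continuous_in_subspaceT => x; rewrite inE /= in_itv /=; exact: cf.
Qed.

(** The integrand may be unbounded at [a]: positivity lets the proper integrals
    from [a + 1 / (n + 1)] to [b] increase to the improper one, while the
    continuity of [F] at [a] gives their limit. *)
Lemma ge0_FTC2_oc (R : realType) (f F : R -> R) (a b : R) : a <= b ->
  (forall x, a < x <= b -> 0 <= f x) ->
  (forall x, a < x <= b -> {for x, continuous f}) ->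
  (forall x, a < x <= b -> is_derive x 1 F (f x)) ->
  F x @[x --> a^'+] --> F a ->
  (\int[lebesgue_measure]_(x in `]a, b]) (f x)%:E = (F b - F a)%:E)%E.
Proof.
rewrite le_eqVlt => /predU1P[->|ab] f0 cf dF Fa.
  by rewrite set_itv_ge ?bnd_simp ?ltxx// integral_set0 subrr.
pose A n : set R := `[a + n.+1%:R^-1, b]%classic.
have lta n : a < a + n.+1%:R^-1 by rewrite ltrDl invr_gt0.
have AP n x : A n x -> a < x <= b.
  by rewrite /A /= in_itv /= => /andP[nx ->]; rewrite (lt_le_trans _ nx).
have An : \bigcup_n A n = `]a, b]%classic.
  apply/seteqP; split => x /=; first by case=> n _ /AP; rewrite in_itv.
  rewrite in_itv /= => /andP[ax xb].
  (* By the choice of the index, [x - a >= 1 / (n + 1)]. *)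
  exists (Num.trunc (x - a)^-1) => //; rewrite /A /= in_itv /= xb andbT.
  rewrite -lerBrDl invf_ple ?posrE ?subr_gt0//.
  by rewrite ltW// truncnS_gt.
have mf : measurable_fun `]a, b] f by exact: continuous_measurable_itv_oc.
have lim1 : (\int[lebesgue_measure]_(x in A n) (f x)%:E)%E @[n --> \oo] -->
    (\int[lebesgue_measure]_(x in `]a, b]) (f x)%:E)%E.
  rewrite -An; apply: ge0_nondecreasing_set_cvg_integral.
  - move=> m n mn; apply/subsetPset => x; rewrite /A /= !in_itv /=.
    move=> /andP[mx ->]; rewrite andbT (le_trans _ mx)// lerD2l lef_pV2 ?posrE//.
    by rewrite ler_nat.
  - by move=> n; exact: measurable_itv.
  - move=> n; apply/measurable_EFinP; apply: measurable_funS mf => //.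
    by move=> x /AP; rewrite /= in_itv.
  - by move=> n x /AP /f0; rewrite lee_fin.
have lim0 : a + n.+1%:R^-1 @[n --> \oo] --> a.
  rewrite -[X in _ --> X]addr0; apply: cvgD; first exact: cvg_cst.
  exact: cvg_harmonic.
have lim2 : (F b - F (a + n.+1%:R^-1))%:E @[n --> \oo] --> (F b - F a)%:E.
  apply: cvg_EFin; first exact: nearW.
  apply: cvgB; first exact: cvg_cst.
  by move/cvg_at_rightP: Fa; apply.
have lim3 : (\int[lebesgue_measure]_(x in A n) (f x)%:E)%E @[n --> \oo] -->
    (F b - F a)%:E.
  apply: cvg_trans lim2; apply: near_eq_cvg.
  have ltb : \forall n \near \oo, a + n.+1%:R^-1 < b.
    exact: (cvgr_lt _ lim0).
  near=> n.
  have nb : a + n.+1%:R^-1 < b by near: n.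
  rewrite (@continuous_FTC2 _ f F)//.
  - apply: continuous_in_subspaceT => x; rewrite inE => /AP; exact: cf.
  - split.
    + move=> x; rewrite in_itv /= => /andP[nx xb].
      by have [] := dF x _; rewrite ?(lt_trans (lta n) nx) ?(ltW xb).
    + apply: cvg_at_right_filter; apply: differentiable_continuous.
      apply/derivable1_diffP.
      by have [] := dF (a + n.+1%:R^-1) _; rewrite ?lta ?ltW.
    + apply: cvg_at_left_filter; apply: differentiable_continuous.
      apply/derivable1_diffP.
      by have [] := dF b _; rewrite ?ab ?lexx.
  - move=> x; rewrite in_itv /= => /andP[nx xb].
    rewrite derive1E; apply: derive_val; apply: dF.
    by rewrite (lt_trans (lta n) nx) ltW.
exact: (cvg_unique _ lim1 lim3).
Unshelve. all: by end_near. Qed.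

(** * The comparison density and its primitive *)

Definition angle_primitive (R : realType) (c u : R) : R :=
  2 / 3 * atan (Num.sqrt ((u / c) ^+ 3 - 1)).

Definition angle_density (R : realType) (c u : R) : R :=
  (u * Num.sqrt ((u / c) ^+ 3 - 1))^-1.

Lemma cube_ratio_gt1 (R : realType) (c u : R) : 0 < c -> c < u ->
  0 < (u / c) ^+ 3 - 1.
Proof.
move=> c0 cu; rewrite subr_gt0 exprn_egt1// ltr_pdivlMr// mul1r //.
Qed.

Lemma angle_primitive_deriv (R : realType) (c u : R) : 0 < c -> c < u ->
  is_derive u 1 (angle_primitive c) (angle_density c u).
Proof.
move=> c0 cu; have w0 := cube_ratio_gt1 c0 cu.
have u0 : 0 < u by exact: lt_trans cu.
have dw : is_derive u 1 (fun v : R => (v / c) ^+ 3 - 1) (3 * (u / c) ^+ 2 / c).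
  apply: is_derive_eq.
  have scaleE (x y : R) : x *: (y : R^o) = x * y by [].
  by rewrite !scaleE; set y := u / c; ring.
pose w v : R := (v / c) ^+ 3 - 1.
have ds := @is_derive1_comp _ Num.sqrt w u _ _ (is_derive1_sqrt w0) dw.
have da := @is_derive1_comp _ atan (Num.sqrt \o w) u _ _ (is_derive1_atan _) ds.
rewrite /angle_primitive.
apply: is_derive_eq (is_deriveZ (2/3) da) _.
rewrite /= /w sqr_sqrtr ?ltW// (addrC 1) subrK /angle_density /GRing.scale /=.
have : Num.sqrt ((u / c) ^+ 3 - 1) != 0 by rewrite gt_eqF// sqrtr_gt0.
set z := Num.sqrt _ => wn0.
field.
by rewrite wn0 (gt_eqF u0) (gt_eqF c0).
Qed.

Lemma sqrt_cube_ratio_cont (R : realType) (c : R) :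
  continuous (fun u : R => Num.sqrt ((u / c) ^+ 3 - 1)).
Proof.
move=> u.
apply: (@continuous_comp _ _ _ (fun u : R => (u / c) ^+ 3 - 1) Num.sqrt u);
  last exact: sqrt_continuous.
apply: cvgB; last exact: cvg_cst.
apply: (@continuous_comp _ _ _ (fun u : R => u / c) (fun x : R => x ^+ 3) u);
  last exact: exprn_continuous.
by apply: cvgM; [exact: cvg_id | exact: cvg_cst].
Qed.

Lemma angle_primitive_cont (R : realType) (c : R) :
  continuous (angle_primitive c).
Proof.
move=> u.
have cat : {for u, continuous (atan \o fun v => Num.sqrt ((v / c) ^+ 3 - 1))}.
  apply: continuous_comp; first exact: sqrt_cube_ratio_cont.
  exact: continuous_atan.
by apply: cvgM; [exact: cvg_cst | exact: cat].
Qed.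

Lemma angle_density_cont (R : realType) (c u : R) : 0 < c -> c < u ->
  {for u, continuous (angle_density c)}.
Proof.
move=> c0 cu; have w0 := cube_ratio_gt1 c0 cu.
have u0 : 0 < u by exact: lt_trans cu.
apply: cvgV; first by rewrite gt_eqF// mulr_gt0// sqrtr_gt0.
by apply: cvgM; [exact: cvg_id | exact: sqrt_cube_ratio_cont].
Qed.

Lemma angle_density_ge0 (R : realType) (c u : R) : 0 < c -> c < u ->
  0 <= angle_density c u.
Proof.
by move=> c0 cu; rewrite invr_ge0 mulr_ge0 ?sqrtr_ge0 // ltW// (lt_trans c0).
Qed.

Lemma angle_density_int (R : realType) (c r b : R) : 0 < c -> c <= r -> r <= b ->
  (\int[lebesgue_measure]_(u in `]r, b]) (angle_density c u)%:E =
   (angle_primitive c b - angle_primitive c r)%:E)%E.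
Proof.
move=> c0 cr rb; apply: ge0_FTC2_oc => //.
- by move=> x /andP[rx _]; apply: angle_density_ge0 => //; exact: le_lt_trans rx.
- by move=> x /andP[rx _]; apply: angle_density_cont => //; exact: le_lt_trans rx.
- move=> x /andP[rx _]; apply: angle_primitive_deriv => //.
  exact: le_lt_trans rx.
- by apply: cvg_at_right_filter; exact: angle_primitive_cont.
Qed.

Lemma angle_density_measurable (R : realType) (c r b : R) : 0 < c -> c <= r ->
  measurable_fun `]r, b] (angle_density c).
Proof.
move=> c0 cr; apply: continuous_measurable_itv_oc => x /andP[rx _].
by apply: angle_density_cont => //; exact: le_lt_trans rx.
Qed.

(** * Two-sided comparison of the strong curve density *)

Lemma fD_denom_gt0 (R : realType) (c D u : R) : 0 < c < 1 ->
  2 * D * (1 - c) = c ^+ 3 -> c < u <= 1 ->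
  0 < u ^+ 5 - 2 * u ^+ 2 * D * (1 - u).
Proof.
move=> /andP[c0 c1] Dc /andP[cu u1].
have u0 : 0 < u by exact: lt_trans cu.
have cu3 : c ^+ 3 < u ^+ 3 by rewrite ltrXn2r// ?nnegrE ltW.
have c30 : 0 < c ^+ 3 by rewrite exprn_gt0.
have key : 0 < (1 - c) * u ^+ 3 - c ^+ 3 * (1 - u) by nra.
rewrite -(pmulr_rgt0 _ (_ : 0 < 1 - c)) ?subr_gt0//.
have -> : (1 - c) * (u ^+ 5 - 2 * u ^+ 2 * D * (1 - u)) =
    u ^+ 2 * ((1 - c) * u ^+ 3 - c ^+ 3 * (1 - u)) by rewrite -Dc; ring.
by rewrite mulr_gt0// exprn_gt0.
Qed.

(** The same density as a single square root, to be compared under the root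
    with the definition of [fD]. *)
Lemma angle_densityE (R : realType) (c u : R) : 0 < c -> c < u ->
  angle_density c u = Num.sqrt (c ^+ 3 / (u ^+ 2 * (u ^+ 3 - c ^+ 3))).
Proof.
move=> c0 cu; have w0 := cube_ratio_gt1 c0 cu.
have u0 : 0 < u by exact: lt_trans cu.
have cu3 : c ^+ 3 < u ^+ 3 by rewrite ltrXn2r// ?nnegrE ltW.
apply/eqP; rewrite -(@eqrXn2 _ 2) ?sqrtr_ge0 ?angle_density_ge0//.
rewrite /angle_density exprVn exprMn !sqr_sqrtr ?(ltW w0)//; last first.
  by rewrite divr_ge0// ?mulr_ge0 ?exprn_ge0 ?subr_ge0 ?ltW.
apply/eqP; field.
by rewrite !gt_eqF ?subr_gt0// ?mulr_gt0 ?exprn_gt0 ?subr_gt0.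
Qed.

(** Under the roots and after clearing denominators, this is
    [(1 - u) * u ^ 3 <= (1 - c) * u ^ 3]. *)
Lemma fD_le_angle_density (R : realType) (c D u : R) : 0 < c < 1 ->
  2 * D * (1 - c) = c ^+ 3 -> c < u <= 1 -> fD D u <= angle_density c u.
Proof.
move=> c01 Dc cu1; have B0 := fD_denom_gt0 c01 Dc cu1.
move: c01 cu1 => /andP[c0 c1] /andP[cu u1].
have u0 : 0 < u by exact: lt_trans cu.
have cu3 : c ^+ 3 < u ^+ 3 by rewrite ltrXn2r// ?nnegrE ltW.
have c30 : 0 < c ^+ 3 by rewrite exprn_gt0.
have u20 : 0 < u ^+ 2 by rewrite exprn_gt0.
rewrite angle_densityE// /fD ler_wsqrtr//.
rewrite ler_pdivrMr// [leRHS]mulrAC ler_pdivlMr ?mulr_gt0 ?subr_gt0//.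
rewrite -(ler_pM2l (_ : 0 < 1 - c)) ?subr_gt0// -subr_ge0.
have -> : (1 - c) * (c ^+ 3 * (u ^+ 5 - 2 * u ^+ 2 * D * (1 - u))) -
    (1 - c) * (2 * (1 - u) * D * (u ^+ 2 * (u ^+ 3 - c ^+ 3))) =
    c ^+ 3 * (u ^+ 5 * (u - c)) +
    (c ^+ 3 - 2 * D * (1 - c)) * (u ^+ 2 * (1 - u) * u ^+ 3) by ring.
by rewrite Dc subrr mul0r addr0 !mulr_ge0 ?exprn_ge0 ?subr_ge0 ?ltW.
Qed.

(** After weakening the factor [1 - u] to its square root, the comparison of the
    radicands reduces to [c ^ 2 <= u ^ 2]. *)
Lemma angle_density_le_fD (R : realType) (c D u : R) : 0 < c < 1 ->
  2 * D * (1 - c) = c ^+ 3 -> c < u <= 1 ->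
  (1 - u) * angle_density c u <= fD D u.
Proof.
move=> c01 Dc cu1; have B0 := fD_denom_gt0 c01 Dc cu1.
move: c01 cu1 => /andP[c0 c1] /andP[cu u1].
have u0 : 0 < u by exact: lt_trans cu.
have cu3 : c ^+ 3 < u ^+ 3 by rewrite ltrXn2r// ?nnegrE ltW.
have c30 : 0 < c ^+ 3 by rewrite exprn_gt0.
have u20 : 0 < u ^+ 2 by rewrite exprn_gt0.
apply: (@le_trans _ _ (Num.sqrt (1 - u) * angle_density c u)).
  apply: ler_wpM2r; first exact: angle_density_ge0.
  have v0 : 0 <= 1 - u by rewrite subr_ge0.
  rewrite -{1}(sqr_sqrtr v0) expr2 ler_piMr ?sqrtr_ge0//.
  by rewrite -[leRHS]sqrtr1 ler_wsqrtr// gerBl ltW.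
rewrite angle_densityE// /fD -sqrtrM ?subr_ge0// ler_wsqrtr//.
rewrite mulrA ler_pdivrMr ?mulr_gt0 ?subr_gt0//.
rewrite [leRHS]mulrAC ler_pdivlMr//.
rewrite -(ler_pM2l (_ : 0 < 1 - c)) ?subr_gt0// -subr_ge0.
have -> : (1 - c) * (2 * (1 - u) * D * (u ^+ 2 * (u ^+ 3 - c ^+ 3))) -
    (1 - c) * ((1 - u) * c ^+ 3 * (u ^+ 5 - 2 * u ^+ 2 * D * (1 - u))) =
    c ^+ 3 * (1 - u) * u ^+ 2 * (c * u * (u ^+ 2 - c ^+ 2)) +
    (2 * D * (1 - c) - c ^+ 3) *
    ((1 - u) * u ^+ 2 * (u ^+ 3 - c ^+ 3) +
       (1 - u) ^+ 2 * c ^+ 3 * u ^+ 2) by ring.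
have cu2 : c ^+ 2 <= u ^+ 2 by rewrite lerXn2r// ?nnegrE ltW.
rewrite Dc subrr mul0r addr0.
by rewrite !mulr_ge0 ?subr_ge0 ?(ltW c0) ?(ltW u0) ?(ltW c30) ?(ltW u20).
Qed.

Lemma fD_measurable (R : realType) (c D : R) : 0 < c < 1 ->
  2 * D * (1 - c) = c ^+ 3 -> measurable_fun `]c, 1] (fD D).
Proof.
move=> c01 Dc; suff cf u : c < u <= 1 -> {for u, continuous (fD D)}.
  exact: continuous_measurable_itv_oc.
move=> cu1; have B0 := fD_denom_gt0 c01 Dc cu1.
have X (n : nat) : (fun x : R => x ^+ n) x @[x --> u] --> u ^+ n.
  exact: exprn_continuous.
have X1 : (fun x : R => 1 - x) x @[x --> u] --> 1 - u.
  by apply: cvgB; [exact: cvg_cst | exact: cvg_id].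
apply: (@continuous_comp _ _ _ (fun u : R =>
  2 * (1 - u) * D / (u ^+ 5 - 2 * u ^+ 2 * D * (1 - u))) Num.sqrt u);
  last exact: sqrt_continuous.
apply: cvgM.
  by apply: cvgM; [apply: cvgM => // | ]; exact: cvg_cst.
apply: cvgV; first by rewrite gt_eqF.
apply: cvgB; first exact: (X 5).
apply: cvgM => //; apply: cvgM; last exact: cvg_cst.
by apply: cvgM; [exact: cvg_cst | exact: (X 2)].
Qed.

Lemma fD_ge0 (R : realType) (D u : R) : 0 <= fD D u.
Proof. exact: sqrtr_ge0. Qed.

Lemma fD_integrable (R : realType) (c D : R) : 0 < c < 1 ->
  2 * D * (1 - c) = c ^+ 3 ->
  lebesgue_measure.-integrable `]c, 1] (EFin \o fD D).
Proof.
move=> c01 Dc; have /andP[c0 c1] := c01.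
apply/integrableP; split.
  by apply/measurable_EFinP; exact: (fD_measurable c01 Dc).
apply: (@le_lt_trans _ _
  (\int[lebesgue_measure]_(u in `]c, 1%R]) (angle_density c u)%:E)%E).
  apply: ge0_le_integral => //.
  - apply/measurable_EFinP; apply: measurableT_comp => //.
    exact: (fD_measurable c01 Dc).
  - by apply/measurable_EFinP; exact: angle_density_measurable.
  - move=> u /=; rewrite in_itv /= => cu1.
    by rewrite ger0_norm ?fD_ge0// lee_fin;
      exact: fD_le_angle_density c01 Dc cu1.
by rewrite angle_density_int ?ltry// ltW.
Qed.

Lemma int_fD_ge0 (R : realType) (D a b : R) : 0 <= int_fD D a b.
Proof. by apply: Rintegral_ge0 => u _; exact: fD_ge0. Qed.

Lemma int_fD_le (R : realType) (c D r : R) : 0 < c < 1 ->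
  2 * D * (1 - c) = c ^+ 3 -> c <= r <= 1 ->
  int_fD D r 1 <= angle_primitive c 1 - angle_primitive c r.
Proof.
move=> c01 Dc /andP[cr r1]; have /andP[c0 c1] := c01.
have sub : `]r, 1] `<=` `]c, 1]%classic.
  by move=> x /=; rewrite !in_itv /= => /andP[rx ->]; rewrite (le_lt_trans cr).
have mf : measurable_fun `]r, 1] (fD D).
  by exact: measurable_funS sub (fD_measurable c01 Dc).
rewrite -[leRHS]/(fine (angle_primitive c 1 - angle_primitive c r)%:E).
rewrite -angle_density_int// /int_fD /Rintegral fine_le//.
- apply: integrable_fin_num => //.
  by apply: integrableS (fD_integrable c01 Dc).
- by rewrite angle_density_int.
apply: ge0_le_integral => //.
- by move=> u _; rewrite lee_fin fD_ge0.
- exact/measurable_EFinP.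
- by apply/measurable_EFinP; exact: angle_density_measurable.
- move=> u /sub /=; rewrite in_itv /= => cu1.
  by rewrite lee_fin; exact: fD_le_angle_density c01 Dc cu1.
Qed.

(** The factor [1 - u] of the pointwise bound is at least [1 - d] before [d], and
    the part of the integral beyond [d] is dropped: the mass of the density
    concentrates near [c] when [c] is small. *)
Lemma int_fD_ge (R : realType) (c D d : R) : 0 < c < 1 ->
  2 * D * (1 - c) = c ^+ 3 -> c <= d <= 1 ->
  (1 - d) * angle_primitive c d <= int_fD D c 1.
Proof.
move=> c01 Dc /andP[cd d1]; have /andP[c0 c1] := c01.
have Fc : angle_primitive c c = 0.
  by rewrite /angle_primitive divff ?gt_eqF// expr1n subrr sqrtr0 atan0 mulr0.
have sub : `]c, d] `<=` `]c, 1]%classic.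
  by move=> x /=; rewrite !in_itv /= => /andP[-> xd]; rewrite (le_trans xd).
have mf := fD_measurable c01 Dc.
rewrite -[leLHS]/(fine ((1 - d) * angle_primitive c d)%:E).
rewrite -[angle_primitive c d]subr0 -Fc EFinM -angle_density_int//.
have If : (\int[lebesgue_measure]_(u in `]c, 1%R]) (fD D u)%:E)%E \is a fin_num.
  by apply: integrable_fin_num => //; exact: (fD_integrable c01 Dc).
rewrite /int_fD /Rintegral fine_le//.
  by rewrite angle_density_int.
rewrite -ge0_integralZl_EFin//=.
- apply: (@le_trans _ _ (\int[lebesgue_measure]_(u in `]c, d]) (fD D u)%:E)%E).
    apply: ge0_le_integral => //.
    + move=> u /=; rewrite in_itv /= => /andP[cu _].
      by rewrite -EFinM lee_fin mulr_ge0 ?angle_density_ge0 ?subr_ge0.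
    + apply: measurable_funeM.
      by apply/measurable_EFinP; exact: angle_density_measurable.
    + by apply/measurable_EFinP; exact: measurable_funS sub mf.
    + move=> u /[dup] /sub /=; rewrite !in_itv /= => cu1 /andP[cu ud].
      rewrite -EFinM lee_fin; apply: le_trans (angle_density_le_fD c01 Dc cu1).
      by apply: ler_wpM2r; [exact: angle_density_ge0 | rewrite lerD2l lerN2].
  apply: ge0_subset_integral => //.
  + exact/measurable_EFinP.
  + by move=> u _; rewrite lee_fin fD_ge0.
- move=> u /=; rewrite in_itv /= => /andP[cu _].
  by rewrite lee_fin angle_density_ge0.
- by apply/measurable_EFinP; exact: angle_density_measurable.
- by rewrite subr_ge0.
Qed.

Lemma int_fD_split (R : realType) (c D r : R) : 0 < c < 1 ->
  2 * D * (1 - c) = c ^+ 3 -> c <= r <= 1 ->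
  int_fD D c 1 = int_fD D c r + int_fD D r 1.
Proof.
move=> c01 Dc /andP[cr r1]; apply/eqP; rewrite addrC -subr_eq; apply/eqP.
by apply: Rintegral_itvB; rewrite ?bnd_simp//; exact: (fD_integrable c01 Dc).
Qed.

(** * Distance from an arm of the strong curve to its limiting ray *)

Lemma angle_primitive_lt (R : realType) (c u : R) :
  angle_primitive c u < pi / 3.
Proof.
have := atan_ltpi2 (Num.sqrt ((u / c) ^+ 3 - 1)).
by rewrite /angle_primitive; lra.
Qed.

Lemma angle_primitive_ge0 (R : realType) (c u : R) : 0 <= angle_primitive c u.
Proof. by rewrite mulr_ge0 ?divr_ge0// -atan0 le_atan// sqrtr_ge0. Qed.

(** With [w] the square root in [angle_primitive c r], the hypothesis gives
    [psi <= pi / 2 - atan w], whence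
    [sin psi <= cos (atan w) = (c / r) ^ (3 / 2)]. *)
Lemma strong_arm_sin_le (R : realType) (c r psi : R) :
  0 < c -> c <= r -> 0 <= psi ->
  psi <= angle_primitive c 1 - angle_primitive c r -> r * sin psi <= c.
Proof.
move=> c0 cr psi0 psi_le; have r0 : 0 < r by exact: lt_le_trans cr.
have := @angle_primitive_lt R c 1.
set w := Num.sqrt ((r / c) ^+ 3 - 1); set y := r / c.
have a0 : 0 <= atan w by rewrite -atan0 le_atan// sqrtr_ge0.
have y1 : 1 <= y by rewrite /y ler_pdivlMr// mul1r.
move=> F1; have psi_y : atan w <= pi / 2 - psi.
  have := angle_primitive_lt c r; move: psi_le.
  rewrite [angle_primitive c r]/angle_primitive -/w; lra.
have pi0 := pi_gt0 R.
have -> : sin psi = cos (pi / 2 - psi).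
  by rewrite cosB cos_pihalf sin_pihalf mul0r add0r mul1r.
apply: (@le_trans _ _ (r * cos (atan w))).
  have aw := atan_ltpi2 w.
  by rewrite ler_pM2l// leNgt ltr_cos ?in_itv /= -?leNgt//; lra.
rewrite cos_atan sqr_sqrtr ?subr_ge0 ?exprn_ege1// (addrC 1) subrK -/y.
have y0 : 0 < y by exact: lt_le_trans y1.
have s0 : 0 < Num.sqrt (y ^+ 3) by rewrite sqrtr_gt0 exprn_gt0.
rewrite ler_pdivrMr// mulrC -ler_pdivrMr// -/y.
rewrite -[leLHS](ger0_norm (ltW y0)) -sqrtr_sqr ler_wsqrtr//.
by apply: ler_weXn2l.
Qed.

(** [r * cos psi] is the radius of the orthogonal projection on the ray of
    angle [a]. *)
Lemma eucl_dist_polar_foot (R : realType) (r a psi : R) :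
  eucl_dist (polar r (a + psi)) (polar (r * cos psi) a) = `|r * sin psi|.
Proof.
rewrite -sqrtr_sqr /eucl_dist /polar /= cosD sinD; congr Num.sqrt.
have := cos2Dsin2 a.
set C := cos a; set S := sin a => CS.
transitivity (r ^+ 2 * sin psi ^+ 2 * (C ^+ 2 + S ^+ 2)); first by ring.
by rewrite CS mulr1 exprMn.
Qed.

Lemma eucl_dist_ge0 (R : realType) (p q : R * R) : 0 <= eucl_dist p q.
Proof. exact: sqrtr_ge0. Qed.

Lemma eucl_dist_polar0 (R : realType) (r a b : R) :
  eucl_dist (polar r a) (polar 0 b) = `|r|.
Proof.
rewrite -sqrtr_sqr /eucl_dist /polar /= !mul0r !subr0; congr Num.sqrt.
by rewrite !exprMn -mulrDr cos2Dsin2 mulr1.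
Qed.

(** * Bounds on the distance of curves *)

Lemma curve_dist_le (R : realType) (a b : R -> R * R) (e : R) :
  (forall s, 0 <= s <= 1 -> exists2 t, 0 <= t <= 1 &
    eucl_dist (a s) (b t) <= e) ->
  (curve_dist a b <= e%:E)%E.
Proof.
move=> H; apply: ge_ereal_sup => _ [s /= s01 <-].
move: s01; rewrite in_itv /= => /H [t t01 le_e].
apply: (@le_trans _ _ (eucl_dist (a s) (b t))%:E); last by rewrite lee_fin.
by apply: ereal_inf_lbound; exists t => //=; rewrite in_itv.
Qed.

Lemma curve_dist_ge0 (R : realType) (a b : R -> R * R) :
  (0 <= curve_dist a b)%E.
Proof.
apply: (@le_trans _ _ (ereal_inf
  [set (eucl_dist (a 0%R) (b t))%:E | t in `[0%R, 1%R]%classic])).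
  by apply: le_ereal_inf_tmp => _ [t _ <-]; rewrite lee_fin eucl_dist_ge0.
by apply: ereal_sup_ubound; exists 0%R => //=; rewrite in_itv /= lexx ler01.
Qed.

(** * The strong curve touching the circle of radius [eps] *)

(** The cubic factors through [y - c] with a cofactor that is positive for
    positive [y]. *)
Lemma rc_eq (R : realType) (c D : R) : 0 < c < 1 ->
  2 * D * (1 - c) = c ^+ 3 -> rc D = c.
Proof.
move=> c01 Dc; have /andP[c0 c1] := c01.
have D0 : 0 < D.
  have : 0 < 2 * D * (1 - c) by rewrite Dc exprn_gt0.
  by rewrite pmulr_lgt0 ?subr_gt0// pmulr_rgt0.
apply: xget_unique => [|y [/andP[y0 y1] yD]] /=.
  by split => //; rewrite -Dc; ring.
have : (y - c) * (y ^+ 2 + y * c + c ^+ 2 + 2 * D) = 0.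
  transitivity ((y ^+ 3 + 2 * D * y - 2 * D) - (c ^+ 3 - 2 * D * (1 - c))).
    by ring.
  by rewrite yD Dc; ring.
move/eqP; rewrite mulf_eq0 subr_eq0 => /predU1P[//|].
by rewrite gt_eqF// !addr_gt0// ?mulr_gt0// exprn_gt0.
Qed.

(** The cubic is affine in [D], so its root [eps] determines [D]. *)
Lemma D_of_radius_eq (R : realType) (eps : R) : 0 < eps < 1 ->
  2 * D_of_radius eps * (1 - eps) = eps ^+ 3.
Proof.
move=> e01; have /andP[e0 e1] := e01.
have e1' : 1 - eps != 0 by rewrite gt_eqF// subr_gt0.
have [D0 rcD] : [set D : R | 0 < D /\ rc D = eps] (D_of_radius eps).
  apply: xgetPex; exists (eps ^+ 3 / (2 * (1 - eps))); split.
    by rewrite divr_gt0 ?mulr_gt0 ?exprn_gt0 ?subr_gt0.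
  by apply: rc_eq => //; field; rewrite e1'.
move: rcD; rewrite /rc; case: xgetP => [r _ [_ req] re|_ /eqP]; last first.
  by rewrite (lt_eqF e0).
by move: req; rewrite re; lra.
Qed.

Lemma s_hit_rc (R : realType) (c D : R) : c < 1 -> rc D = c -> s_hit c D = 2^-1.
Proof.
move=> c1 rcD.
have half_le s : rS D s = c -> 2^-1 <= s.
  rewrite /rS rcD; case: leP => [s2|/ltW//] h.
  suff /eqP : (c - 1) * (2 * s - 1) = 0.
    by rewrite mulf_eq0 subr_eq0 (lt_eqF c1) /= => /eqP; lra.
  by move: h; lra.
have half_in : [set s : R | 0 <= s <= 1 /\ rS D s = c] 2^-1.
  split; first by lra.
  by rewrite /rS lexx rcD; field.
apply: xget_unique => [|y [[_ yc] ymin]].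
  by split => // y [_]; exact: half_le.
by apply/le_anti; rewrite half_le// ymin.
Qed.

(** * The critical angle tends to [pi / 3] from below *)

Lemma rS_half (R : realType) (D : R) : rS D 2^-1 = rc D.
Proof. by rewrite /rS lexx; field. Qed.

Lemma theta_cE (R : realType) (eps : R) : 0 < eps < 1 ->
  theta_c eps = int_fD (D_of_radius eps) eps 1.
Proof.
move=> e01; have Dc := D_of_radius_eq e01.
by rewrite /theta_c /thetaS lexx rS_half (rc_eq e01 Dc).
Qed.

Lemma theta_c_lt (R : realType) (eps : R) : 0 < eps < 1 -> theta_c eps < pi / 3.
Proof.
move=> e01; have Dc := D_of_radius_eq e01; rewrite theta_cE//.
have /andP[_ e1] := e01.
have := @int_fD_le R eps (D_of_radius eps) eps e01 Dc.
rewrite lexx (ltW e1) => /(_ isT) /le_lt_trans; apply.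
have := angle_primitive_lt eps 1; have := angle_primitive_ge0 eps eps; lra.
Qed.

(** Choosing [d] so that [(1 - d) * (pi / 3)] exceeds [a], it remains to have
    [angle_primitive eps d >= a / (1 - d)], that is [atan] of the root at least
    [b < pi / 2]; this holds as soon as [d / eps >= 1 + tan b ^ 2]. *)
Lemma theta_c_ge (R : realType) (a : R) : a < pi / 3 ->
  \forall eps \near 0^'+, a <= theta_c eps.
Proof.
move=> a_lt; have [a0|a0] := leP a 0.
  near=> eps; apply: le_trans a0 _; rewrite theta_cE ?int_fD_ge0//.
  by apply/andP; split; near: eps; [exact: nbhs_right_gt | exact: nbhs_right_lt].
have pi0 := pi_gt0 R.
(* Then [(1 - d) * (pi / 3)] lies between [a] and [pi / 3], closer to the latter. *)
pose d := (pi / 3 - a) / pi.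
have d0 : 0 < d by rewrite divr_gt0// subr_gt0.
have dpi : d * pi = pi / 3 - a by rewrite /d divfK ?gt_eqF.
have d1 : d < 1 by rewrite -(ltr_pM2r pi0) dpi; lra.
pose b := a / (1 - d) * (3 / 2).
have bd : b * (1 - d) = a * (3 / 2).
  by rewrite /b; field; rewrite gt_eqF// subr_gt0.
have b0 : 0 < b by rewrite mulr_gt0// divr_gt0// subr_gt0.
have b_lt : b < pi / 2.
  rewrite -(ltr_pM2r (_ : 0 < 1 - d)) ?subr_gt0// bd.
  have -> : pi / 2 * (1 - d) = pi / 2 - d * pi / 2 by field.
  by rewrite dpi; lra.
pose T := tan b.
have eT : 0 < d / (1 + T ^+ 2) by rewrite divr_gt0// ltr_wpDr ?sqr_ge0.
near=> eps.
have e0 : 0 < eps by near: eps; exact: nbhs_right_gt.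
have e1 : eps < 1 by near: eps; exact: nbhs_right_lt.
have ed : eps < d / (1 + T ^+ 2) by near: eps; exact: nbhs_right_lt.
have e01 : 0 < eps < 1 by rewrite e0.
have Te : 1 + T ^+ 2 <= d / eps.
  by rewrite ler_pdivlMr// mulrC -ler_pdivlMr ?ltr_wpDr ?sqr_ge0// ltW.
have y1 : 1 <= d / eps by apply: le_trans Te; rewrite lerDl sqr_ge0.
rewrite theta_cE//.
have Dc := D_of_radius_eq e01.
apply: le_trans (@int_fD_ge R eps (D_of_radius eps) d e01 Dc _); last first.
  by rewrite (ltW d1) andbT; move: y1; rewrite ler_pdivlMr// mul1r.
have : b <= atan (Num.sqrt ((d / eps) ^+ 3 - 1)).
  rewrite -[leLHS](@tanK R) ?in_itv /=; last by rewrite b_lt andbT; lra.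
  apply: le_atan; apply: (le_trans (ler_norm _)); rewrite -sqrtr_sqr ler_wsqrtr//.
  rewrite lerBrDl (le_trans Te)//.
  by rewrite -[leLHS]expr1; exact: ler_weXn2l.
rewrite -(ler_pM2r (_ : 0 < 1 - d)) ?subr_gt0// bd /angle_primitive; lra.
Unshelve. all: by end_near. Qed.

(** * The riding curve approaches the weak curve *)

(** The weak curve runs along both rays. The origin is reached at the middle
    parameter, which carries the angle of the first ray, so it is treated apart
    on the second one. *)
Lemma weak_curve_rays (R : realType) (thf x : R) : 0 <= x <= 1 ->
  [/\ exists2 t, 0 <= t <= 1 & polar (rW t) (thetaW thf t) = polar x 0 &
      exists2 t, 0 <= t <= 1 & polar (rW t) (thetaW thf t) = polar x thf].
Proof.
move=> /andP[x0 x1]; split.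
  exists ((1 - x) / 2); first by lra.
  rewrite /rW /thetaW ifT ?ifT; [|lra|lra].
  by congr polar; field.
have [->|x_neq0] := eqVneq x 0.
  exists 2^-1; first by lra.
  by rewrite /rW /thetaW lexx /polar mulfV// subrr !mul0r.
have x_gt0 : 0 < x by rewrite lt_neqAle eq_sym x_neq0.
exists ((1 + x) / 2); first by lra.
rewrite /rW /thetaW ifF ?ifF; [|apply/negbTE; rewrite -ltNge; lra..].
by congr polar; field.
Qed.

(** The angle swept from the outer circle stays below [pi / 3], so the foot of
    the perpendicular falls on the ray, inside the unit disk. *)
Lemma strong_arm_foot (R : realType) (c D r : R) : 0 < c < 1 ->
  2 * D * (1 - c) = c ^+ 3 -> c <= r <= 1 ->
  [/\ 0 <= r * cos (int_fD D r 1) <= 1, 0 <= r * sin (int_fD D r 1) &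
      r * sin (int_fD D r 1) <= c].
Proof.
move=> c01 Dc cr1; have ub := int_fD_le c01 Dc cr1.
have lb := int_fD_ge0 D r 1.
move: c01 cr1 ub lb => /andP[c0 c1] /andP[cr r1].
set psi := int_fD D r 1 => ub lb; have r0 : 0 < r by exact: lt_le_trans cr.
have psi_lt : psi < pi / 3.
  have := angle_primitive_lt c 1; have := angle_primitive_ge0 c r; lra.
have pi0 := pi_gt0 R.
split.
- have cos0 : 0 <= cos psi by apply: ltW; apply: cos_gt0_pihalf; lra.
  by rewrite mulr_ge0 ?mulr_ile1 ?cos_le1 ?(ltW r0).
- by rewrite mulr_ge0 ?(ltW r0)// sin_ge0_pi//; lra.
- exact: strong_arm_sin_le ub.
Qed.

(** The curves of the last third are those of the first one mirrored: the angle
    there is [thf] minus the integral from the current radius to [1]. *)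
Lemma riding_curve_near_weak (R : realType) (eps thf s : R) : 0 < eps < 1 ->
  0 <= s <= 1 ->
  exists2 t, 0 <= t <= 1 &
    eucl_dist (riding_curve eps (D_of_radius eps) thf s)
              (polar (rW t) (thetaW thf t)) <= eps.
Proof.
move=> e01 /andP[s0 s1]; have Dc := D_of_radius_eq e01.
set D := D_of_radius eps in Dc *.
have rcD := rc_eq e01 Dc; have /andP[e0 e1] := e01.
rewrite /riding_curve (s_hit_rc e1 rcD).
case: ifPn => [s_lt|]; last case: ifPn => [_ _|].
- set h := 3 * 2^-1 * s; have h2 : h <= 2^-1 by rewrite /h; lra.
  have h0 : 0 <= h by rewrite /h; lra.
  have rh : eps <= rS D h <= 1 by rewrite /rS h2 rcD; apply/andP; split; nra.
  rewrite /thetaS h2; have [c01 sin0 sin_le] := strong_arm_foot e01 Dc rh.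
  have [[t t01 tE] _] := weak_curve_rays thf c01.
  exists t => //; rewrite tE -[X in polar (rS D h) X]add0r eucl_dist_polar_foot.
  by rewrite ger0_norm.
- have [|[t t01 tE] _] := @weak_curve_rays R thf 0; first by rewrite lexx ler01.
  by exists t => //; rewrite tE eucl_dist_polar0 gtr0_norm.
- rewrite -ltNge => s23 _.
  set j := 3 * 2^-1 * s + 1 - 3 * 2^-1.
  have j2 : 2^-1 < j by rewrite /j; lra.
  have jF : (j <= 2^-1) = false by apply/negbTE; rewrite -ltNge.
  have j1 : j <= 1 by rewrite /j; lra.
  have rj : eps <= rS D j <= 1.
    by rewrite /rS jF rcD; apply/andP; split; nra.
  have r1 : rS D 1 = 1 by rewrite /rS ifF ?subrr ?mulr0 ?add0r//; lra.
  have -> : thetaS D j + thf - thetaS D 1 = thf + - int_fD D (rS D j) 1.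
    rewrite /thetaS jF ifF; last by apply/negbTE; rewrite -ltNge; lra.
    rewrite rS_half r1 rcD {3}(int_fD_split e01 Dc rj); ring.
  have [c01 sin0 sin_le] := strong_arm_foot e01 Dc rj.
  have [_ [t t01 tE]] := weak_curve_rays thf c01.
  exists t => //; rewrite tE -cosN eucl_dist_polar_foot sinN mulrN normrN.
  by rewrite ger0_norm.
Qed.

Theorem proposition9 (R : realType) (thf : R) (hthf : 0 < thf < pi) :
  curve_dist (annulus_curve eps thf) (disk_curve thf) @[eps --> 0^'+] --> 0%E.
Proof.
apply: (@squeeze_cvge _ _ _ _ (cst 0%E) _ (fun eps : R => eps%:E)).
- have angle_cond : \forall eps \near 0^'+,
      thf < 2 * pi / 3 -> thf / 2 <= theta_c eps.
    have [thf_lt|thf_ge] := ltP thf (2 * pi / 3); last exact: nearW.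
    by apply: filterS (@theta_c_ge R (thf / 2) _) => //; lra.
  near=> eps; rewrite curve_dist_ge0 /=; apply: curve_dist_le => s s01.
  have e0 : 0 < eps by near: eps; exact: nbhs_right_gt.
  have e1 : eps < 1 by near: eps; exact: nbhs_right_lt.
  rewrite /disk_curve; case: ltP => [thf_lt|thf_ge].
    exists s => //; rewrite /annulus_curve ifT.
      by rewrite /eucl_dist !subrr expr0n addr0 sqrtr0 ltW.
    by move: thf_lt; near: eps.
  rewrite /annulus_curve ifF.
    by apply: riding_curve_near_weak => //; rewrite e0.
  apply/negbTE; rewrite -ltNge.
  have : theta_c eps < pi / 3 by apply: theta_c_lt; rewrite e0.
  lra.
- exact: cvg_cst.
- apply: cvg_EFin; first exact: nearW.
  apply: cvg_at_right_filter; exact: cvg_id.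
Unshelve. all: by end_near. Qed.
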